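(* Let $(V,C,u)$ and $(W,K,e)$ be complete order unit spaces such that $V$ is spanned by the atoms of $C$. If there exists a gauge-reversing map $\Psi\colon C^\circ\to K^\circ$, then $C^\circ$ is homogeneous, i.e., the group $\mathrm{Aut}(C)=\{T\in\mathrm{GL}(V)\colon T(C)=C\}$ acts transitively on $C^\circ$.
   Context: An order unit space $(V,C,u)$ consists of a real vector space $V$, a cone $C\subseteq V$ (convex, $\lambda C\subseteq C$ for $\lambda\ge 0$, $C\cap -C=\{0\}$) with ordering $v\le w$ iff $w-v\in C$, such that $C$ is Archimedean (if $v\in V$, $w\in C$ and $nv\le w$ for all $n\in\mathbb{N}$, then $v\le 0$), and an order unit $u\in C$ (for each $v\in V$ there is $\lambda\ge0$ with $-\lambda u\le v\le\lambda u$). $V$ carries the order unit norm $\|v\|_u=\inf\{\lambda\ge0\colon -\lambda u\le v\le\lambda u\}$; complete means complete for this norm, and $C^\circ$ is the interior of $C$. For $v\in V$, $w\in C^\circ$ put $M(v/w)=\inf\{\mu\in\mathbb{R}\colon v\le\mu w\}$. A bijection $\Psi\colon C^\circ\to K^\circ$ between interiors of the cones of order unit spaces is gauge-reversing if $M(v/w)=M(\Psi(w)/\Psi(v))$ for all $v,w\in C^\circ$. An extreme vector of $C$ is a nonzero $r\in C$ such that $0\le v\le r$ implies $v=\lambda r$ for some $\lambda\ge0$. An atom of $C$ is an extreme vector $p$ with $M(p/u)=1$. *)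

(* Defs.v *)
From HB Require Import structures.
From mathcomp Require Import all_boot all_order all_algebra.
From mathcomp Require Import all_classical all_reals all_analysis.

Set Implicit Arguments.
Unset Strict Implicit.
Unset Printing Implicit Defensive.

Import Order.TTheory GRing.Theory Num.Theory.
Import numFieldNormedType.Exports.

Local Open Scope classical_set_scope.
Local Open Scope ring_scope.

Definition is_cone (R : realType) (V : lmodType R) (C : set V) : Prop :=
  [/\ convex_set (C : set (convex_lmodType V)),
      (forall (l : R) (v : V), 0 <= l -> C v -> C (l *: v)) &
      C `&` (-%R @` C) = [set 0]].

Definition cone_le (R : realType) (V : lmodType R) (C : set V) (v w : V) : Prop :=
  C (w - v).

Definition archimedean_cone (R : realType) (V : lmodType R) (C : set V) : Prop :=
  forall v w : V, C w -> (forall n : nat, cone_le C (v *+ n) w) -> cone_le C v 0.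

Definition is_order_unit (R : realType) (V : lmodType R) (C : set V) (u : V) : Prop :=
  C u /\
  forall v : V, exists l : R,
    [/\ 0 <= l, cone_le C (- (l *: u)) v & cone_le C v (l *: u)].

Definition order_unit_norm (R : realType) (V : lmodType R) (C : set V) (u v : V) : R :=
  inf [set l : R |
    [/\ 0 <= l, cone_le C (- (l *: u)) v & cone_le C v (l *: u)]].

(* The last field says that the norm carried by the type V is the order unit
   norm; in a normedModType the norm determines the topology and uniformity, so
   the library's interior and completeness on V are those of the order unit norm. *)
Record is_order_unit_space (R : realType) (V : normedModType R)
    (C : set V) (u : V) : Prop := IsOrderUnitSpace {
  ous_cone : is_cone C;
  ous_archimedean : archimedean_cone C;
  ous_unit : is_order_unit C u;
  ous_norm : forall v : V, `|v| = order_unit_norm C u v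
}.

(* M(v/w).  For w in the interior of C the set below is nonempty and bounded
   below, except when V = 0: it is then all of R and inf has its default
   value 0. *)
Definition gaugeM (R : realType) (V : lmodType R) (C : set V) (v w : V) : R :=
  inf [set m : R | cone_le C v (m *: w)].

Definition gauge_reversing (R : realType) (V W : normedModType R)
    (C : set V) (K : set W) (Psi : V -> W) : Prop :=
  set_bij C° K° Psi /\
  forall v w : V, C° v -> C° w -> gaugeM C v w = gaugeM K (Psi w) (Psi v).

Definition extreme_vector (R : realType) (V : lmodType R) (C : set V) (r : V) : Prop :=
  [/\ r != 0, C r &
      forall v : V, cone_le C 0 v -> cone_le C v r ->
        exists2 l : R, 0 <= l & v = l *: r].

Definition atom (R : realType) (V : lmodType R) (C : set V) (u p : V) : Prop :=
  extreme_vector C p /\ gaugeM C p u = 1.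

Definition spanned_by (R : realType) (V : lmodType R) (A : set V) : Prop :=
  forall v : V, exists (n : nat) (a : 'I_n -> R) (p : 'I_n -> V),
    (forall i, A (p i)) /\ v = \sum_(i < n) a i *: p i.

Definition cone_automorphism (R : realType) (V : lmodType R) (C : set V)
    (T : {linear V -> V}) : Prop :=
  bijective T /\ T @` C = C.

Definition homogeneous_cone (R : realType) (V : normedModType R) (C : set V) : Prop :=
  forall v w : V, C° v -> C° w ->
    exists T : {linear V -> V}, cone_automorphism C T /\ T v = w.

(* Main.v *)
Require Import Defs.
From HB Require Import structures.
From mathcomp Require Import all_boot all_order all_algebra.
From mathcomp Require Import all_classical all_reals all_analysis.
From mathcomp Require Import ring lra.

Set Implicit Arguments.
Unset Strict Implicit.
Unset Printing Implicit Defensive.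

Import Order.TTheory GRing.Theory Num.Theory.
Import numFieldNormedType.Exports.
Local Open Scope classical_set_scope.
Local Open Scope ring_scope.

(** Gauge reversal says exactly that [v <= m w] iff [Psi w <= m Psi v], for
    interior [v], [w] and real [m].  So [Psi] reverses the order, is homogeneous
    of degree [-1], and maps order intervals onto order intervals.  The proof
    differentiates [Psi] by using only its behaviour along extreme directions.

    Let [p] be extreme and [z] interior, and put [lam = M(p/z)].  The order
    interval [[z, z + s p]] is a segment, and comparing gauges on both sides
    shows that [Psi] maps it onto a segment, with an explicit parametrization
    ([reversal_segment], [reversal_ray]):
<<
      Psi (z + s p) = Psi z - s / (1 + s lam) * D_z p,
>>
    where [D_z p] is an extreme vector of [K] with [M(D_z p / Psi z) = lam].
    The map [Psi^-1] sends the ray of [D_z p] at [Psi z] back to the ray of [p]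
    at [z] ([reversal_line], [ray_slope_extreme], [ray_slope_inv]).

    In this formula [Psi], the gauge and hence [D_z p] are continuous in [z], so
    [Psi] has one-sided directional derivatives along all finite combinations of
    extreme vectors, and they are additive ([right_slopeD]).  Since the extreme
    vectors span [V], this extends [D_x] to a linear map on [V].  It is positive
    because [Psi] is antitone, and [D_x x = Psi x] by homogeneity.  The last
    identity shows that the extreme vectors of [K] span [W]; hence the inverse of
    [Psi] also has a derivative [E_y], and [E_(Psi x)] is inverse to [D_x], as can
    be checked on extreme vectors ([image_generated], [right_deriv_inv]).  Thus
    each [D_x] is a linear isomorphism that maps [C] onto [K].

    For interior [x], [z] the map [E_(Psi z) D_x] is an automorphism of [C], and
    it sends [x] to [E_(Psi z) (Psi x)], the image of [x] under the point symmetry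
    at [z].  With [z = x + s p] the formula above evaluates this image to
    [x + (2 s + s^2 lam) p], so [x] is in the same orbit as every [x + t p] with
    [t >= 0] ([conjugate_ray]).  Any two interior points [x], [y] satisfy
    [x + g = y + h] for sums [g], [h] of nonnegative multiples of extreme
    vectors, so they are in the same orbit ([reversal_homogeneous]). *)

(** * Identities between linear combinations *)

(** Expressions for linear combinations of vectors, the syntax on which the
    tactic [module_eq] works by reflection. *)
Section LinearExpressions.
Variables (R : comNzRingType) (V : lmodType R).

Inductive lexp : Type :=
| LVar of nat
| LZero
| LAdd of lexp & lexp
| LOpp of lexp
| LScale of R & lexp.

Fixpoint leval (env : seq V) (a : lexp) : V :=
  match a with
  | LVar i => nth 0 env i
  | LZero => 0
  | LAdd a b => leval env a + leval env b
  | LOpp a => - leval env a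
  | LScale k a => k *: leval env a
  end.

Fixpoint lcoef (a : lexp) (i : nat) : R :=
  match a with
  | LVar j => if eqn j i then 1 else 0
  | LZero => 0
  | LAdd a b => lcoef a i + lcoef b i
  | LOpp a => - lcoef a i
  | LScale k a => k * lcoef a i
  end.

Fixpoint lcoef_eq (n : nat) (a b : lexp) : Prop :=
  if n is m.+1 then lcoef a m = lcoef b m /\ lcoef_eq m a b else True.

Lemma leval_sum env a :
  leval env a = \sum_(i < size env) lcoef a i *: nth 0 env i.
Proof.
elim: a => [j||a IHa b IHb|a IHa|k a IHa] /=.
- have E i : eqn j i = (j == i) by rewrite eqnE.
  under eq_bigr do rewrite E.
  have [ltj|lej] := ltnP j (size env); last first.
    rewrite nth_default // big1 // => i _.
    by rewrite (gtn_eqF (leq_trans (ltn_ord i) lej)) scale0r.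
  rewrite (bigD1 (Ordinal ltj)) //= eqxx scale1r big1 ?addr0 // => i nij.
  by rewrite -[j]/(val (Ordinal ltj)) val_eqE eq_sym (negbTE nij) scale0r.
- by rewrite big1 // => i _; rewrite scale0r.
- by rewrite IHa IHb -big_split; apply: eq_bigr => i _; rewrite scalerDl.
- by rewrite IHa -sumrN; apply: eq_bigr => i _; rewrite scaleNr.
- by rewrite IHa scaler_sumr; apply: eq_bigr => i _; rewrite scalerA.
Qed.

(** Coefficients are compared vector by vector without any assumption of
    independence, so this is a sufficient condition for equality only. *)
Lemma leval_eq env a b : lcoef_eq (size env) a b -> leval env a = leval env b.
Proof.
move=> ab; rewrite !leval_sum; apply: eq_bigr => i _; congr (_ *: _).
elim: (size env) ab (nat_of_ord i) (ltn_ord i) => // n IHn [abn abs] j.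
by rewrite ltnS leq_eqVlt => /predU1P[->//|]; apply: IHn.
Qed.

End LinearExpressions.

Ltac lvar_mem x env :=
  match env with
  | nil => constr:(false)
  | x :: _ => constr:(true)
  | _ :: ?env' => lvar_mem x env'
  end.

Ltac lvar_index x env :=
  match env with
  | x :: _ => constr:(0%N)
  | _ :: ?env' => let i := lvar_index x env' in constr:(i.+1)
  end.

Ltac lvars env t :=
  match t with
  | (?a + ?b)%R => let env := lvars env a in lvars env b
  | (- ?a)%R => lvars env a
  | (_ *: ?a)%R => lvars env a
  | 0%R => env
  | ?x => match lvar_mem x env with
          | true => env
          | false => constr:(x :: env)
          end
  end.

Ltac lreify R env t :=
  match t with
  | (?a + ?b)%R =>
    let a := lreify R env a in let b := lreify R env b in
    constr:(@LAdd R a b)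
  | (- ?a)%R => let a := lreify R env a in constr:(@LOpp R a)
  | (?k *: ?a)%R => let a := lreify R env a in constr:(@LScale R k a)
  | 0%R => constr:(@LZero R)
  | ?x => let i := lvar_index x env in constr:(@LVar R i)
  end.

(** Reduces an equality of linear combinations in [V] to one scalar equality per
    vector, left to [ring] or [field]. *)
Ltac module_eq R V :=
  match goal with
  | |- ?a = ?b =>
    let env := lvars (@nil V) a in
    let env := lvars env b in
    let a' := lreify R env a in
    let b' := lreify R env b in
    refine (@leval_eq R V env a' b' _);
    cbv [lcoef_eq lcoef eqn size];
    repeat match goal with |- _ /\ _ => split | |- True => exact I end
  end.

(** * Order unit spaces *)

Section OrderUnitSpace.
Variables (R : realType) (V : normedModType R) (C : set V) (u : V).
Hypothesis hC : is_order_unit_space C u.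

Ltac vec := module_eq R V.

Lemma coneZ (l : R) (x : V) : 0 <= l -> C x -> C (l *: x).
Proof. by case: (ous_cone hC) => _ CZ _; apply: CZ. Qed.

Lemma cone0 : C 0.
Proof.
case: (ous_cone hC) => _ _ C0.
by have : [set 0] (0 : V) by []; rewrite -C0 => -[].
Qed.

Lemma cone_anti (x : V) : C x -> C (- x) -> x = 0.
Proof.
case: (ous_cone hC) => _ _ C0 Cx CNx.
suff : [set 0] x by [].
by rewrite -C0; split=> //; exists (- x) => //; rewrite opprK.
Qed.

Lemma coneD (x y : V) : C x -> C y -> C (x + y).
Proof.
case: (ous_cone hC) => cvxC _ _ Cx Cy.
have h0 : 0 <= 2^-1 :> R by lra.
have h1 : 2^-1 <= 1 :> R by lra.
have := cvxC x y (Itv01 h0 h1); rewrite !inE => /(_ Cx Cy) Cxy.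
have {Cxy}Cxy : C (2^-1 *: x + (1 - 2^-1) *: y) by [].
suff -> : x + y = 2 *: (2^-1 *: x + (1 - 2^-1) *: y) by apply: coneZ => //; lra.
by vec; field.
Qed.

Lemma cone_scaled a x z : C x -> 0 <= a -> z = a *: x -> C z.
Proof. by move=> Cx a0 ->; apply: coneZ. Qed.

Lemma cone_comb a b x y z :
  C x -> C y -> 0 <= a -> 0 <= b -> z = a *: x + b *: y -> C z.
Proof. by move=> Cx Cy a0 b0 ->; apply: coneD; apply: coneZ. Qed.

#[local] Arguments cone_scaled a {x z}.
#[local] Arguments cone_comb a b {x y z}.

Lemma cone_unit : C u.
Proof. by case: (ous_unit hC). Qed.

Lemma unit_dom (x : V) : exists2 l : R, 0 < l & C (l *: u - x) /\ C (l *: u + x).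
Proof.
case: (ous_unit hC) => Cu /(_ x) [l [l0 xl lx]].
rewrite /cone_le in xl lx.
exists (l + 1); first lra.
split; first by apply: (cone_comb 1 1 lx Cu); [lra|lra|vec; ring].
by apply: (cone_comb 1 1 xl Cu); [lra|lra|vec; ring].
Qed.

(** The Archimedean axiom, in the form of closedness in the direction of the unit;
    it is what makes the infima in the norm and in the gauge attained. *)
Lemma cone_unit_closed (x : V) : (forall a : R, 0 < a -> C (x + a *: u)) -> C x.
Proof.
move=> xC; suff : cone_le C (- x) 0 by rewrite /cone_le sub0r opprK.
apply: (ous_archimedean hC) cone_unit _ => n; rewrite /cone_le.
case: n => [|n]; first by rewrite mulr0n subr0; exact: cone_unit.
have n0 : 0 < n.+1%:R :> R by rewrite ltr0n.
have ninv : 0 < (n.+1%:R : R)^-1 by rewrite invr_gt0.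
apply: (cone_scaled n.+1%:R (xC _ ninv) (ltW n0)).
rewrite -scaler_nat; vec; field; lra.
Qed.

(** Since the infimum is attained, the norm can be replaced by the order in all
    topological arguments. *)
Lemma norm_leP (l : R) (x : V) : 0 <= l ->
  (`|x| <= l) <-> C (l *: u - x) /\ C (l *: u + x).
Proof.
move=> l0; rewrite (ous_norm hC) /order_unit_norm.
set S := [set _ | _].
have SE m : S m <-> [/\ 0 <= m, C (m *: u - x) & C (m *: u + x)].
  rewrite /S /= /cone_le; have -> : x - - (m *: u) = m *: u + x by vec; ring.
  by split=> -[].
have S0 : has_lbound S by exists 0 => m /SE[].
split=> [xl|[lx xl]]; last by apply: ge_inf => //; apply/SE.
have hS : has_inf S.
  split=> //; have [m m0 [h1 h2]] := unit_dom x.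
  by exists m; apply/SE; split=> //; exact: ltW.
have near_l (a : R) : 0 < a -> exists2 m : R, S m & m <= l + a.
  move=> a0; have [m Sm ml] := inf_adherent a0 hS.
  by exists m => //; rewrite (le_trans (ltW ml)) // lerD2r.
split; apply: cone_unit_closed => a /near_l[m /SE[m0 h1 h2] ml].
  by apply: (cone_comb 1 (l + a - m) h1 cone_unit); [lra|lra|vec; ring].
by apply: (cone_comb 1 (l + a - m) h2 cone_unit); [lra|lra|vec; ring].
Qed.

Lemma cone_closed : closed C.
Proof.
move=> x xC; apply: cone_unit_closed => a a0.
have [y [Cy]] := xC _ (nbhsx_ballx x a a0).
rewrite -ball_normE /ball_ /= => /ltW /(norm_leP _ (ltW a0))[_ h].
by apply: (cone_comb 1 1 Cy h); [lra|lra|vec; ring].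
Qed.

Lemma interiorP (x : V) : C° x <-> exists2 a : R, 0 < a & C (x - a *: u).
Proof.
split=> [/nbhs_ballP[a /= a0 xa]|[a a0 Cx]].
  exists (a / 2); first lra.
  apply: xa; rewrite -ball_normE /ball_ /=.
  have -> : x - (x - (a / 2) *: u) = (a / 2) *: u by vec; ring.
  have a20 : 0 <= a / 2 by lra.
  suff : `|(a / 2) *: u| <= a / 2 by move/le_lt_trans; apply; lra.
  apply/norm_leP => //; split; first by rewrite subrr; exact: cone0.
  by apply: coneD; apply: coneZ cone_unit.
apply/nbhs_ballP; exists a => //= y.
rewrite -ball_normE /ball_ /= => /ltW /(norm_leP _ (ltW a0))[h _].
by apply: (cone_comb 1 1 Cx h); [lra|lra|vec; ring].
Qed.

Lemma interior_cone (x : V) : C° x -> C x.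
Proof. exact: interior_subset. Qed.

Lemma interiorD (x y : V) : C° x -> C y -> C° (x + y).
Proof.
move=> /interiorP[a a0 Cx] Cy; apply/interiorP; exists a => //.
by apply: (cone_comb 1 1 Cx Cy); [lra|lra|vec; ring].
Qed.

Lemma interiorZ (l : R) (x : V) : 0 < l -> C° x -> C° (l *: x).
Proof.
move=> l0 /interiorP[a a0 Cx]; apply/interiorP; exists (l * a).
  exact: mulr_gt0.
by apply: (cone_scaled l Cx (ltW l0)); vec; ring.
Qed.

Lemma interior_unit : C° u.
Proof.
apply/interiorP; exists 1 => //; rewrite scale1r subrr; exact: cone0.
Qed.

(** Every interior point is again an order unit. *)
Lemma interior_dom (x v : V) : C° x -> exists2 l : R, 0 < l & C (l *: x - v).
Proof.
move=> /interiorP[a a0 Cx]; have [l l0 [h _]] := unit_dom v.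
exists (l / a); first exact: divr_gt0.
apply: (cone_comb (l / a) 1 Cx h) => //; first by rewrite ltW ?divr_gt0.
vec; field; lra.
Qed.

Lemma interior_closed (x v : V) : C° x ->
  (forall a : R, 0 < a -> C (v + a *: x)) -> C v.
Proof.
move=> ix vC; apply: cone_unit_closed => a a0.
have [l l0 [h _]] := unit_dom x.
have al : 0 < a / l by apply: divr_gt0.
apply: (cone_comb 1 (a / l) (vC _ al) h); rewrite ?(ltW al) //.
vec; field; lra.
Qed.

Lemma cone_scale_ge0 (a : R) (x : V) : C x -> x != 0 -> C (a *: x) -> 0 <= a.
Proof.
move=> Cx x0 Cax; rewrite leNgt; apply/negP => a0; have /negP := x0; apply.
apply/eqP/cone_anti => //; apply: (cone_scaled (- a^-1) Cax).
  by rewrite oppr_ge0 invr_le0 ltW.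
by vec; field; rewrite lt_eqF.
Qed.

Hypothesis u0 : u != 0.

Lemma interior_neq0 (x : V) : C° x -> x != 0.
Proof.
move=> ix; apply/eqP => x0; case/interiorP: ix => a a0; rewrite x0 sub0r => h.
have : a *: u = 0 by apply: cone_anti h; apply: coneZ (ltW a0) cone_unit.
by move/eqP; rewrite scaler_eq0 (negbTE u0) orbF => /eqP; lra.
Qed.

(** The infimum defining the gauge is attained, so that the gauge encodes the
    order relation between [v] and the multiples of [x]. *)
Lemma gauge_leP (v x : V) (m : R) : C° x -> C (m *: x - v) <-> gaugeM C v x <= m.
Proof.
move=> ix; rewrite /gaugeM; set S := [set _ | _].
have Cx := interior_cone ix.
have [l l0 hl] := interior_dom v ix; have [k k0 hk] := interior_dom (- v) ix.
have Sk : lbound S (- k).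
  move=> m'; rewrite /S /= /cone_le => h; rewrite leNgt; apply/negP => mk.
  have h0 : C ((m' + k) *: x).
    by apply: (cone_comb 1 1 h hk); [lra|lra|vec; ring].
  have : (m' + k) *: x = 0.
    apply: cone_anti h0 _; apply: (cone_scaled (- (m' + k)) Cx); first lra.
    by vec; ring.
  move/eqP; rewrite scaler_eq0 (negbTE (interior_neq0 ix)) orbF => /eqP; lra.
have hS : has_inf S by split; [exists l|exists (- k)].
split=> [h|mS]; first by apply: ge_inf => //; exists (- k).
apply: (interior_closed ix) => a a0.
have [m' Sm' m'l] := inf_adherent a0 hS.
by apply: (cone_comb 1 (m + a - m') Sm' Cx); [lra|lra|vec; ring].
Qed.

Lemma gauge_ge0 (v x : V) : C° x -> C v -> 0 <= gaugeM C v x.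
Proof.
move=> ix Cv; set g := gaugeM C v x; rewrite leNgt; apply/negP => g0.
have Cx := interior_cone ix.
have /(gauge_leP _ _ ix) h : gaugeM C v x <= g by [].
suff : 0 <= g by lra.
apply: (cone_scale_ge0 Cx (interior_neq0 ix)).
by apply: (cone_comb 1 1 h Cv); [lra|lra|vec; ring].
Qed.

(** For [a > 0] this is [gauge_leP] rescaled; for [a <= 0] both sides hold because
    [b >= 0].  The absence of a sign condition on [a] avoids case distinctions
    when points of a ray are compared. *)
Lemma gauge_scaleP (v x : V) (a b : R) : C° x -> C v -> 0 <= b ->
  C (b *: x - a *: v) <-> a * gaugeM C v x <= b.
Proof.
move=> ix Cv b0; have g0 := gauge_ge0 ix Cv.
have [a0|a0] := ltP 0 a.
  have -> : (a * gaugeM C v x <= b) = (gaugeM C v x <= b / a).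
    by rewrite ler_pdivlMr // mulrC.
  rewrite -gauge_leP //; split=> h.
    apply: (cone_scaled a^-1 h); first by rewrite invr_ge0 ltW.
    by vec; field; lra.
  by apply: (cone_scaled a h (ltW a0)); vec; field; lra.
split=> [_|_].
  by rewrite (le_trans _ b0) // mulr_le0_ge0.
apply: (cone_comb b (- a) (interior_cone ix) Cv) => //; first lra.
by vec; ring.
Qed.

Lemma gauge_gt0 (v x : V) : C° x -> C v -> v != 0 -> 0 < gaugeM C v x.
Proof.
move=> ix Cv v0; rewrite lt_def gauge_ge0 // andbT; apply: contraNneq v0 => g0.
apply/eqP/cone_anti => //.
have /(gauge_leP _ _ ix) : gaugeM C v x <= 0 by rewrite g0.
by rewrite scale0r sub0r.
Qed.

(** [p <= m (x + r p)] iff [(1 - m r) p <= m x]. *)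
Lemma gauge_shift (p x : V) (r : R) : C° x -> C p -> 0 <= r ->
  gaugeM C p (x + r *: p) = gaugeM C p x / (1 + r * gaugeM C p x).
Proof.
move=> ix Cp r0; have g0 := gauge_ge0 ix Cp.
have rg0 : 0 < 1 + r * gaugeM C p x by rewrite ltr_wpDr // mulr_ge0.
have ixr : C° (x + r *: p) by apply: interiorD ix (coneZ r0 Cp).
have gP m : 0 <= m ->
    (gaugeM C p (x + r *: p) <= m) = (gaugeM C p x / (1 + r * gaugeM C p x) <= m).
  move=> m0; rewrite ler_pdivrMr //.
  have -> : (gaugeM C p x <= m * (1 + r * gaugeM C p x)) =
            ((1 - m * r) * gaugeM C p x <= m).
    by apply/idP/idP; lra.
  apply/idP/idP => [/(gauge_leP _ _ ixr) h|/(gauge_scaleP _ ix Cp m0) h].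
    apply/(gauge_scaleP _ ix Cp m0).
    by apply: (cone_scaled 1 h) => //; vec; ring.
  apply/(gauge_leP _ _ ixr).
  by apply: (cone_scaled 1 h) => //; vec; ring.
apply: le_anti; rewrite gP; last by rewrite divr_ge0 // ltW.
by rewrite -(gP _ (gauge_ge0 ixr Cp)) !lexx.
Qed.

Lemma extremeZ (l : R) (p : V) :
  0 < l -> extreme_vector C p -> extreme_vector C (l *: p).
Proof.
move=> l0 [p0 Cp extp]; have ln0 : l != 0 by rewrite gt_eqF.
split; first by rewrite scaler_eq0 negb_or ln0.
  exact: coneZ (ltW l0) Cp.
move=> v; rewrite /cone_le subr0 => v0 vp.
have li0 : 0 <= l^-1 by rewrite invr_ge0 ltW.
have [||k k0 vE] := extp (l^-1 *: v); rewrite /cone_le.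
- by apply: (cone_scaled l^-1 v0) => //; vec; ring.
- by apply: (cone_scaled l^-1 vp) => //; vec; field.
exists k => //; have -> : v = l *: (l^-1 *: v) by vec; field.
by rewrite vE; vec; ring.
Qed.

End OrderUnitSpace.

Arguments cone_scaled {R V C u} hC a {x z}.
Arguments cone_comb {R V C u} hC a b {x y z}.
Arguments gauge_leP {R V C u} hC u0 {v x m}.
Arguments gauge_scaleP {R V C u} hC u0 {v x a b}.

(** * Gauge-reversing maps along extreme directions *)

(** Gauge reversal in terms of the orders alone, for a map [Psi] given together
    with its inverse [Phi]: the form of the hypothesis that is symmetric in the
    two spaces. *)
Record order_reversal (R : realType) (V W : normedModType R)
    (C : set V) (K : set W) (Psi : V -> W) (Phi : W -> V) : Prop :=
  OrderReversal {
  rev_int : forall x, C° x -> K° (Psi x);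
  rev_int_inv : forall y, K° y -> C° (Phi y);
  revK : forall x, C° x -> Phi (Psi x) = x;
  revVK : forall y, K° y -> Psi (Phi y) = y;
  rev_le : forall x y m, C° x -> C° y ->
    C (m *: y - x) <-> K (m *: Psi x - Psi y)
}.

Lemma order_reversal_sym (R : realType) (V W : normedModType R)
    (C : set V) (K : set W) (Psi : V -> W) (Phi : W -> V) :
  order_reversal C K Psi Phi -> order_reversal K C Phi Psi.
Proof.
case=> h1 h2 h3 h4 h5; split=> // x y m Kx Ky.
by rewrite (h5 (Phi y) (Phi x)) ?h4 //; apply: h2.
Qed.

(** The vector written [D_z p] in the introduction: minus the derivative of [Psi]
    at [x] in the extreme direction [p], recovered from the single step [t = 1] by
    means of the formula in [reversal_ray]. *)
Definition ray_slope (R : realType) (V W : normedModType R) (C : set V)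
    (Psi : V -> W) (x p : V) : W :=
  (1 + gaugeM C p x) *: (Psi x - Psi (x + p)).

Section ExtremeDirections.
Variables (R : realType) (V W : normedModType R).
Variables (C : set V) (u : V) (K : set W) (e : W).
Hypotheses (hC : is_order_unit_space C u) (hK : is_order_unit_space K e).
Hypotheses (u0 : u != 0) (e0 : e != 0).
Variables (Psi : V -> W) (Phi : W -> V).
Hypothesis rev : order_reversal C K Psi Phi.

Ltac vecV := module_eq R V.
Ltac vecW := module_eq R W.

Lemma rev_anti (x y : V) : C° x -> C° y -> C (y - x) <-> K (Psi x - Psi y).
Proof. by move=> ix iy; have := rev_le rev 1 ix iy; rewrite !scale1r. Qed.

(** An order interval in an extreme direction is a segment, and [Phi] maps order
    intervals onto order intervals. *)
Lemma reversal_interval (z p : V) (c : W) :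
  C° z -> extreme_vector C p -> K c -> K (Psi z - Psi (z + p) - c) ->
  exists r : R, [/\ 0 <= r, r <= 1 & Psi (z + r *: p) = Psi (z + p) + c].
Proof.
move=> iz [p0 Cp extp] Kc Kzc.
have izp := interiorD hC iz Cp.
have iBc : K° (Psi (z + p) + c) := interiorD hK (rev_int rev izp) Kc.
have ix : C° (Phi (Psi (z + p) + c)) := rev_int_inv rev iBc.
have Psix := revVK rev iBc; set x := Phi _ in ix Psix.
have Czx : C (x - z).
  apply/rev_anti => //; rewrite Psix.
  by apply: (cone_scaled hK 1 Kzc) => //; vecW; ring.
have Cxz : C (z + p - x).
  apply/rev_anti => //; rewrite Psix.
  by apply: (cone_scaled hK 1 Kc) => //; vecW; ring.
have [||r r0 xzE] := extp (x - z); rewrite /cone_le ?subr0 //.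
  by apply: (cone_scaled hC 1 Cxz) => //; vecV; ring.
exists r; split=> //; last by rewrite -xzE addrC subrK.
suff : 0 <= 1 - r by lra.
apply: (cone_scale_ge0 hC Cp p0); rewrite scalerBl -xzE scale1r.
by apply: (cone_scaled hC 1 Cxz) => //; vecV; ring.
Qed.

(** [Psi] maps the segment from [z] to [z + s p] onto the segment from [Psi z] to
    [Psi (z + s p)].  The parameter of a point is found by computing its gauge
    relative to the endpoint [z + s p], which [Psi] preserves up to exchanging the
    arguments. *)
Lemma reversal_segment (z p : V) (r s : R) :
  C° z -> extreme_vector C p -> 0 <= r -> r <= s -> 0 < s ->
  Psi (z + r *: p) = Psi (z + s *: p) +
    ((s - r) / (s * (1 + r * gaugeM C p z))) *: (Psi z - Psi (z + s *: p)).
Proof.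
move=> iz extp r0 rs s0; have [p0 Cp _] := extp.
set lam := gaugeM C p z.
have lam0 : 0 < lam := gauge_gt0 hC u0 iz Cp p0.
set B := Psi (z + s *: p); set d := Psi z - B; set l := _ / _.
have izs : C° (z + s *: p) := interiorD hC iz (coneZ hC (ltW s0) Cp).
have iB : K° B := rev_int rev izs.
have Kd : K d.
  by apply/rev_anti => //; apply: (cone_scaled hC s Cp (ltW s0)); vecV; ring.
have rl0 : 0 < 1 + r * lam by rewrite ltr_wpDr // mulr_ge0 // ltW.
have l0 : 0 <= l by rewrite divr_ge0 ?mulr_ge0 ?subr_ge0 // ltW.
have l1 : l <= 1.
  rewrite ler_pdivrMr ?mulr_gt0 //; have : 0 <= s * (r * lam); last by lra.
  by rewrite !mulr_ge0 // ltW.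
have [||k [k0 k1 PsixE]] := reversal_interval (c := l *: d) iz (extremeZ hC s0 extp).
- exact: (coneZ hK l0 Kd).
- by apply: (cone_scaled hK (1 - l) Kd); [lra|rewrite /d -/B; vecW; ring].
have [r' [r'0 r's Psix]] : exists r' : R,
    [/\ 0 <= r', r' <= s & Psi (z + r' *: p) = B + l *: d].
  exists (k * s); rewrite -scalerA; split=> //; first by rewrite mulr_ge0 // ltW.
  by rewrite ler_piMl // ltW.
set x := z + r' *: p in Psix.
have ix : C° x := interiorD hC iz (coneZ hC r'0 Cp).
(* Both sides compare [z + s p] with multiples of [z], the left one through [Psi]. *)
have gd : gaugeM K d B = s * lam.
  have gdP n : 0 <= n -> (s * lam <= n) = (gaugeM K d B <= n).
    move=> n0; rewrite -[gaugeM _ _ _]mul1r; apply/idP/idP.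
      move/(gauge_scaleP hC u0 iz Cp n0) => h.
      apply/(gauge_scaleP hK e0 iB Kd n0).
      have /(rev_le rev (1 + n) izs iz) : C ((1 + n) *: z - (z + s *: p)).
        by apply: (cone_scaled hC 1 h) => //; vecV; ring.
      rewrite -/B => h'; apply: (cone_scaled hK 1 h') => //.
      by rewrite /d; vecW; ring.
    move/(gauge_scaleP hK e0 iB Kd n0) => h.
    apply/(gauge_scaleP hC u0 iz Cp n0).
    have /(rev_le rev (1 + n) izs iz) : K ((1 + n) *: B - Psi z).
      by apply: (cone_scaled hK 1 h) => //; rewrite /d; vecW; ring.
    by move=> h'; apply: (cone_scaled hC 1 h') => //; vecV; ring.
  have slam0 : 0 <= s * lam by rewrite mulr_ge0 // ltW.
  apply: le_anti; rewrite -(gdP _ slam0) lexx /= gdP //.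
  exact: (gauge_ge0 hK e0 iB Kd).
(* The same comparison for [x]; this determines [r'] from [l], and the choice of
   [l] makes the solution [r' = r]. *)
have gx n : 0 <= n -> ((s - (1 + n) * r') * lam <= n) = (l * (s * lam) <= n).
  move=> n0; rewrite -gd; apply/idP/idP.
    move/(gauge_scaleP hC u0 iz Cp n0) => h.
    apply/(gauge_scaleP hK e0 iB Kd n0).
    have /(rev_le rev (1 + n) izs ix) : C ((1 + n) *: x - (z + s *: p)).
      by apply: (cone_scaled hC 1 h) => //; rewrite /x; vecV; ring.
    rewrite Psix -/B => h'.
    by apply: (cone_scaled hK 1 h') => //; vecW; ring.
  move/(gauge_scaleP hK e0 iB Kd n0) => h.
  apply/(gauge_scaleP hC u0 iz Cp n0).
  have /(rev_le rev (1 + n) izs ix) : K ((1 + n) *: B - Psi x).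
    by rewrite Psix; apply: (cone_scaled hK 1 h) => //; vecW; ring.
  by move=> h'; apply: (cone_scaled hC 1 h') => //; rewrite /x; vecV; ring.
have lE : l * (s * lam) = (1 + s * lam) / (1 + r * lam) - 1.
  by rewrite /l -/lam; field; rewrite !gt_eqF.
have r'l0 : 0 < 1 + r' * lam by rewrite ltr_wpDr // mulr_ge0 // ltW.
have sl0 : 0 < 1 + s * lam by rewrite ltr_wpDr // mulr_ge0 // ltW.
have r'E : r' = r.
  apply/eqP; rewrite eq_le; apply/andP; split.
    have n0 : 0 <= (1 + s * lam) / (1 + r' * lam) - 1.
      by rewrite subr_ge0 ler_pdivlMr // mul1r lerD2l ler_pM2r.
    have := gx _ n0; rewrite lE lerD2r ler_pM2l // lef_pV2 ?posrE //.
    rewrite lerD2l ler_pM2r // => <-; rewrite -subr_ge0 le_eqVlt; apply/orP.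
    by left; apply/eqP; field; rewrite gt_eqF.
  have n0 : 0 <= l * (s * lam) by rewrite mulr_ge0 // mulr_ge0 ?ltW.
  have := gx _ n0; rewrite lexx lE => h.
  have {}h : (1 + s * lam) / (1 + r' * lam) <= (1 + s * lam) / (1 + r * lam).
    by rewrite ler_pdivrMr //; lra.
  by move: h; rewrite ler_pM2l // lef_pV2 ?posrE // lerD2l ler_pM2r.
by rewrite -r'E.
Qed.

Local Notation D := (ray_slope C Psi).

Lemma reversal_ray (z p : V) (s : R) :
  C° z -> extreme_vector C p -> 0 <= s ->
  Psi (z + s *: p) = Psi z - (s / (1 + s * gaugeM C p z)) *: D z p.
Proof.
move=> iz extp s0; have [p0 Cp _] := extp.
rewrite /ray_slope; set lam := gaugeM C p z.
have lam0 : 0 < lam := gauge_gt0 hC u0 iz Cp p0.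
have sl0 : 0 < 1 + s * lam by rewrite ltr_wpDr // mulr_ge0 // ltW.
have [s1|/ltW s1] := leP s 1.
  have := reversal_segment iz extp s0 s1 ltr01; rewrite -/lam scale1r => ->.
  by vecW; field; lra.
have {}s0 : 0 < s by lra.
have := reversal_segment iz extp ler01 s1 s0; rewrite -/lam scale1r => ->.
by vecW; field; rewrite !gt_eqF //; lra.
Qed.

Lemma reversal_line (z p : V) (s : R) :
  C° z -> extreme_vector C p -> C° (z + s *: p) ->
  0 < 1 + s * gaugeM C p z /\
  Psi (z + s *: p) = Psi z - (s / (1 + s * gaugeM C p z)) *: D z p.
Proof.
move=> iz extp izs; have [p0 Cp _] := extp.
have lam0 : 0 < gaugeM C p z := gauge_gt0 hC u0 iz Cp p0.
have [s0|s0] := leP 0 s.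
  by split; [rewrite ltr_wpDr // mulr_ge0 // ltW|apply: reversal_ray].
have lam'0 := gauge_gt0 hC u0 izs Cp p0.
(* For [s < 0] the point [z] lies on the forward ray from [z' = z + s p], so
   both slopes are computed from there. *)
set z' := z + s *: p in izs lam'0 *.
set lam' := gaugeM C p z' in lam'0.
have r0 : 0 <= - s by lra.
have zE : z = z' + (- s) *: p by rewrite /z'; vecV; ring.
have lamE : gaugeM C p z = lam' / (1 + - s * lam').
  by rewrite {1}zE (gauge_shift hC u0 izs Cp r0).
have sl0 : 0 < 1 + - s * lam' by rewrite ltr_wpDr // mulr_ge0 // ltW.
have sl1 : 0 < 1 + (1 - s) * lam' by rewrite ltr_wpDr // mulr_ge0 ?(ltW lam'0) //; lra.
have Psiz := reversal_ray izs extp r0; rewrite -zE -/lam' in Psiz.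
have Psizp : Psi (z + p) = Psi z' - ((1 - s) / (1 + (1 - s) * lam')) *: D z' p.
  rewrite -(reversal_ray izs extp); last lra.
  by congr Psi; rewrite {1}zE; vecV; ring.
have E : 1 + s * gaugeM C p z = (1 + - s * lam')^-1.
  by rewrite lamE; field; rewrite gt_eqF.
split; first by rewrite E invr_gt0.
rewrite E /ray_slope lamE Psizp Psiz.
by vecW; field; rewrite !gt_eqF.
Qed.

Lemma ray_slope_cone (z p : V) : C° z -> C p -> K (D z p).
Proof.
move=> iz Cp; apply: (coneZ hK); first by have := gauge_ge0 hC u0 iz Cp; lra.
apply/(rev_anti iz (interiorD hC iz Cp)).
by apply: (cone_scaled hC 1 Cp) => //; vecV; ring.
Qed.

(** An element below [D_z p], scaled by [(1 + lam)^-1], is below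
    [Psi z - Psi (z + p)], hence is a difference of values of [Psi] on the ray. *)
Lemma ray_slope_extreme (z p : V) :
  C° z -> extreme_vector C p -> extreme_vector K (D z p).
Proof.
move=> iz extp; have [p0 Cp _] := extp.
have KD := ray_slope_cone iz Cp.
have lam0 := gauge_gt0 hC u0 iz Cp p0.
split=> // [|c].
  rewrite scaler_eq0 negb_or gt_eqF ?addr_gt0 //= subr_eq0.
  apply: contra_neq p0 => PsiE.
  have := revK rev (interiorD hC iz Cp); rewrite -PsiE (revK rev iz) => zE.
  by rewrite -[p](addKr z) -zE addNr.
rewrite /cone_le subr0 => Kc KDc; set lam := gaugeM C p z in lam0.
have l1 : 0 <= (1 + lam)^-1 by rewrite invr_ge0; lra.
have Kc' := coneZ hK l1 Kc.
have [|k [k0 k1]] := reversal_interval iz extp Kc'.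
  apply: (cone_scaled hK _ KDc l1).
  by rewrite /ray_slope -/lam; vecW; field; lra.
rewrite (reversal_ray iz extp k0) -/lam => PsiE.
have kl0 : 0 < 1 + k * lam by rewrite ltr_wpDr // mulr_ge0 // ltW.
exists ((1 - k) / (1 + k * lam)); first by rewrite divr_ge0 ?(ltW kl0) // subr_ge0.
have -> : c = (1 + lam) *: (Psi (z + p) + (1 + lam)^-1 *: c - Psi (z + p)).
  by vecW; field; lra.
rewrite -PsiE /ray_slope -/lam.
by vecW; field; rewrite !gt_eqF // addr_gt0.
Qed.

(** The gauge of [z + p] over [z] is [1 + lam], and it equals that of [Psi z] over
    [Psi (z + p) = Psi z - (1 + lam)^-1 D_z p]. *)
Lemma gauge_ray_slope (z p : V) :
  C° z -> extreme_vector C p -> gaugeM K (D z p) (Psi z) = gaugeM C p z.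
Proof.
move=> iz extp; have [p0 Cp _] := extp.
have KD := ray_slope_cone iz Cp.
have iPz := rev_int rev iz.
have lam0 := gauge_gt0 hC u0 iz Cp p0; set lam := gaugeM C p z in lam0 *.
have g0 := gauge_ge0 hK e0 iPz KD; set g := gaugeM K _ _ in g0 *.
have izp : C° (z + p) := interiorD hC iz Cp.
have gP n : 0 <= n -> (lam <= n) = ((1 + n) / (1 + lam) * g <= n).
  move=> n0; rewrite -[lam in LHS]mul1r; apply/idP/idP.
    move=> /(gauge_scaleP hC u0 iz Cp n0) h.
    apply/(gauge_scaleP hK e0 iPz KD n0).
    have /(rev_le rev (1 + n) izp iz) h' : C ((1 + n) *: z - (z + p)).
      by apply: (cone_scaled hC 1 h) => //; vecV; ring.
    apply: (cone_scaled hK 1 h') => //.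
    by rewrite /ray_slope -/lam; vecW; field; lra.
  move=> /(gauge_scaleP hK e0 iPz KD n0) h.
  apply/(gauge_scaleP hC u0 iz Cp n0).
  have /(rev_le rev (1 + n) izp iz) h' : K ((1 + n) *: Psi (z + p) - Psi z).
    apply: (cone_scaled hK 1 h) => //.
    by rewrite /ray_slope -/lam; vecW; field; lra.
  by apply: (cone_scaled hC 1 h') => //; vecV; ring.
have glam : g <= lam.
  have := gP _ (ltW lam0); rewrite lexx => /esym.
  by rewrite divff ?mul1r // gt_eqF // addr_gt0.
apply: le_anti; rewrite glam /=.
(* This [n] satisfies [(1 + n) / (1 + lam) * g = n], the equality case of [gP]. *)
have d0 : 0 < 1 + lam - g by lra.
have n0 : 0 <= (1 + lam) / (1 + lam - g) - 1.
  by rewrite subr_ge0 ler_pdivlMr // mul1r; lra.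
have : lam <= (1 + lam) / (1 + lam - g) - 1.
  rewrite gP // le_eqVlt; apply/orP; left; apply/eqP; field.
  by rewrite !gt_eqF // addr_gt0.
rewrite lerBrDr ler_pdivlMr // => h.
have : 0 <= (g - lam) * (1 + lam) by lra.
by rewrite pmulr_lge0 ?addr_gt0 // subr_ge0.
Qed.

(** [Psi (z - (1 + lam)^-1 *: p) = Psi z + D z p], read backwards. *)
Lemma ray_slope_inv (z p : V) :
  C° z -> extreme_vector C p -> ray_slope K Phi (Psi z) (D z p) = p.
Proof.
move=> iz extp; have [p0 Cp _] := extp.
rewrite /ray_slope -/(D z p) gauge_ray_slope //.
have lam0 := gauge_gt0 hC u0 iz Cp p0; set lam := gaugeM C p z in lam0 *.
have lz : 0 <= (1 + lam)^-1 by rewrite invr_ge0; lra.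
have iy : C° (z + (- (1 + lam)^-1) *: p).
  have iz' : C° ((1 + lam)^-1 *: z).
    by apply: (interiorZ hC _ iz); rewrite invr_gt0; lra.
  have Cz : C (lam *: z - p) by apply/(gauge_leP hC u0 iz).
  have := interiorD hC iz' (coneZ hC lz Cz).
  by congr (C° _); vecV; field; lra.
have [_ Psiy] := reversal_line iz extp iy.
have {}Psiy : Psi (z + (- (1 + lam)^-1) *: p) = Psi z + D z p.
  by rewrite Psiy -/lam; vecW; field; lra.
rewrite -Psiy (revK rev iz) (revK rev iy).
by vecV; field; lra.
Qed.

End ExtremeDirections.

(** * Differentiability of gauge-reversing maps *)

Section Continuity.
Variables (R : realType) (V : normedModType R) (C : set V) (u : V).
Hypothesis hC : is_order_unit_space C u.

Ltac vec := module_eq R V.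

(** Near an interior point the topology is that of the multiplicative comparison
    [y <= (1 + d) x], [x <= (1 + d) y], which order-reversing homogeneous maps and
    gauges respect. *)
Lemma near_interior (x : V) (d : R) : C° x -> 0 < d ->
  \forall y \near x, [/\ C° y, C ((1 + d) *: x - y) & C ((1 + d) *: y - x)].
Proof.
move=> ix d0; have [a a0 Cxa] := (interiorP hC x).1 ix.
have Cx := interior_cone ix.
have d1 : 0 < 1 + d by lra.
(* Chosen so that [(1 + d) * (1 - d') = 1]. *)
pose d' := d / (1 + d); have d'0 : 0 < d' by apply: divr_gt0.
have d'1 : d' < 1 by rewrite ltr_pdivrMr // mul1r; lra.
have d'd : d' <= d by rewrite ler_pdivrMr // ler_peMr //; lra.
have r0 : 0 < d' * a by apply: mulr_gt0.
near=> y.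
have /(norm_leP hC _ (ltW r0)) [h1 h2] : `|x - y| <= d' * a.
  near: y; move: (@cvg_id _ (nbhs x)) => /cvgrPdist_le; exact.
split.
- apply/(interiorP hC); exists ((1 - d') * a); first by apply: mulr_gt0 => //; lra.
  by apply: (cone_comb hC 1 1 h1 Cxa); [lra|lra|vec; ring].
- have h := cone_comb hC 1 d' h2 Cxa ler01 (ltW d'0) erefl.
  by apply: (cone_comb hC 1 (d - d') h Cx); [lra|lra|vec; ring].
- have h := cone_comb hC (1 + d) ((1 + d) * d') h1 Cxa (ltW d1) _ erefl.
  apply: (cone_scaled hC 1 (h _)) => //; first by rewrite mulr_ge0 ?ltW.
  by vec; rewrite /d'; field; lra.
Unshelve. all: by end_near. Qed.

Hypothesis u0 : u != 0.

Lemma gauge_continuous (p x : V) : C p -> C° x -> {for x, continuous (gaugeM C p)}.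
Proof.
move=> Cp ix; apply/cvgrPdist_le => /= a a0.
have g0 := gauge_ge0 hC u0 ix Cp; set g := gaugeM C p x in g0 *.
have g1 : 0 < 2 * g + 1 by lra.
pose d := Num.min 1 (a / (2 * g + 1)).
have d0 : 0 < d by rewrite lt_min ltr01 divr_gt0.
have d1 : d <= 1 by rewrite ge_min lexx.
have dg : d * (2 * g + 1) <= a by rewrite -ler_pdivlMr // ge_min lexx orbT.
near=> y.
have [iy h1 h2] : [/\ C° y, C ((1 + d) *: x - y) & C ((1 + d) *: y - x)].
  by near: y; apply: near_interior.
have gy0 := gauge_ge0 hC u0 iy Cp; set gy := gaugeM C p y in gy0 *.
have hx : C (g *: x - p) by apply/(gauge_leP hC u0 ix).
have hy : C (gy *: y - p) by apply/(gauge_leP hC u0 iy).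
have gyg : gy <= g * (1 + d).
  apply/(gauge_leP hC u0 iy).
  by apply: (cone_comb hC g 1 h2 hx) => //; vec; ring.
have ggy : g <= gy * (1 + d).
  apply/(gauge_leP hC u0 ix).
  by apply: (cone_comb hC gy 1 h1 hy) => //; vec; ring.
have : d * g <= a by rewrite (le_trans _ dg) // ler_pM2l //; lra.
have : gy * d <= (2 * g) * d.
  rewrite ler_pM2r // (le_trans gyg) // mulrC ler_wpM2r //; lra.
rewrite ler_norml; lra.
Unshelve. all: by end_near. Qed.

End Continuity.

Section Derivative.
Variables (R : realType) (V W : normedModType R).
Variables (C : set V) (u : V) (K : set W) (e : W).
Hypotheses (hC : is_order_unit_space C u) (hK : is_order_unit_space K e).
Hypotheses (u0 : u != 0) (e0 : e != 0).
Variables (Psi : V -> W) (Phi : W -> V).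
Hypothesis rev : order_reversal C K Psi Phi.

Ltac vecV := module_eq R V.
Ltac vecW := module_eq R W.
Local Notation D := (ray_slope C Psi).

Lemma reversal_continuous (x : V) : C° x -> {for x, continuous Psi}.
Proof.
move=> ix; apply/cvgrPdist_le => /= a a0.
have iPx := rev_int rev ix; have KPx := interior_cone iPx.
have [k k0 Kk] := interior_dom hK (Psi x) (interior_unit hK).
pose d := Num.min 1 (a / (2 * k)).
have d0 : 0 < d by rewrite lt_min ltr01 divr_gt0 // mulr_gt0.
have d1 : d <= 1 by rewrite ge_min lexx.
have dk : 2 * (d * k) <= a.
  have : d * (2 * k) <= a; last by lra.
  by rewrite -ler_pdivlMr ?mulr_gt0 // ge_min lexx orbT.
near=> y.
have [iy] : [/\ C° y, C ((1 + d) *: x - y) & C ((1 + d) *: y - x)].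
  by near: y; apply: (near_interior hC).
move=> /(rev_le rev (1 + d) iy ix) h1 /(rev_le rev (1 + d) ix iy) h2.
have dk0 : 0 <= d * k by rewrite mulr_ge0 // ltW.
have ddk : d * d * k <= d * k by rewrite -mulrA ler_piMl.
have da : 0 <= d * (1 + d) by rewrite mulr_ge0 ?ltW // addr_gt0.
apply/(norm_leP hK _ (ltW a0)); split.
  have h3 := cone_comb hK d (d * (1 + d)) h2 Kk (ltW d0) da erefl.
  have h4 := cone_comb hK 1 1 h1 h3 ler01 ler01 erefl.
  apply: (cone_comb hK 1 (a - d * (1 + d) * k) h4 (cone_unit hK)) => //; first lra.
  by vecW; ring.
have h3 := cone_comb hK 1 d h2 Kk ler01 (ltW d0) erefl.
apply: (cone_comb hK 1 (a - d * k) h3 (cone_unit hK)) => //; first lra.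
by vecW; ring.
Unshelve. all: by end_near. Qed.

Lemma ray_slope_continuous (x p : V) : C° x -> C p ->
  {for x, continuous (fun y => D y p)}.
Proof.
move=> ix Cp; apply: cvgZ.
  by apply: cvgD; [exact: cvg_cst|exact: (gauge_continuous hC u0 Cp ix)].
apply: cvgB; first exact: reversal_continuous.
apply: (@continuous_cvg _ _ _ _ _ (fun y => y + p) Psi).
  exact: (reversal_continuous (interiorD hC ix Cp)).
by apply: cvgD; [exact: cvg_id|exact: cvg_cst].
Qed.

Definition right_slope (x v : V) (t : R) : W :=
  t^-1 *: (Psi x - Psi (x + t *: v)).

Lemma cvg_ray0 (x v : V) : x + t *: v @[t --> 0^'+] --> x.
Proof.
apply: cvg_at_right_filter; rewrite -[X in _ --> X]addr0 -(scale0r v).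
apply: cvgD; first exact: cvg_cst.
by apply: cvgZ; [exact: cvg_id|exact: cvg_cst].
Qed.

Lemma near_ray0 (x v : V) : C° x -> \forall t \near 0^'+, C° (x + t *: v).
Proof.
by move=> ix; exact: (@cvg_ray0 x v _ (nbhs_interior ix)). Qed.

(** The increment along [v + a p] is the increment along [v] followed by a step in
    the extreme direction [p] from the moving point [x + t v]; the latter is given
    exactly by [reversal_line], and its slope is continuous in the base point. *)
Lemma right_slopeD (x v p : V) (a : R) (d : W) :
  C° x -> extreme_vector C p ->
  right_slope x v t @[t --> 0^'+] --> d ->
  right_slope x (v + a *: p) t @[t --> 0^'+] --> d + a *: D x p.
Proof.
move=> ix extp vd; have [p0 Cp _] := extp.
pose c t := a / (1 + (t * a) * gaugeM C p (x + t *: v)).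
have cP : c t @[t --> 0^'+] --> a.
  rewrite -[X in _ --> X]divr1 -[X in _ / X]addr0 -[X in 1 + X](mul0r (gaugeM C p x)).
  rewrite -[X in X * gaugeM _ _ _](mul0r a).
  apply: cvgM; first exact: cvg_cst.
  apply: cvgV; first by rewrite !mul0r addr0 oner_neq0.
  apply: cvgD; first exact: cvg_cst.
  apply: cvgM; first by apply: cvgM; [exact: cvg_at_right_filter cvg_id|exact: cvg_cst].
  apply: (@continuous_cvg _ _ _ _ _ (fun t => x + t *: v) (gaugeM C p)).
    exact: (gauge_continuous hC u0 Cp ix).
  exact: cvg_ray0.
have DP : c t *: D (x + t *: v) p @[t --> 0^'+] --> a *: D x p.
  apply: cvgZ => //.
  apply: (@continuous_cvg _ _ _ _ _ (fun t => x + t *: v) (fun y => D y p)).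
    exact: ray_slope_continuous.
  exact: cvg_ray0.
apply: cvg_trans (cvgD vd DP); apply: near_eq_cvg; near=> t.
have t0 : 0 < t by near: t; exact: nbhs_right_gt.
have ixt : C° (x + t *: v) by near: t; exact: near_ray0.
have ixt' : C° (x + t *: v + (t * a) *: p).
  have -> : x + t *: v + (t * a) *: p = x + t *: (v + a *: p) by vecV; ring.
  by near: t; exact: near_ray0.
have [pos E] := reversal_line hC hK u0 e0 rev ixt extp ixt'.
have xE : x + t *: (v + a *: p) = x + t *: v + (t * a) *: p by vecV; ring.
rewrite fctE /right_slope xE E /c.
by vecW; field; rewrite !gt_eqF.
Unshelve. all: by end_near. Qed.
End Derivative.

(** * The derivative as a linear isomorphism of cones *)

(** Linear generation in impredicative form: a linear property that holds on [A]
    holds everywhere.  It lets linear identities be propagated from the extreme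
    vectors without handling coordinates. *)
Definition lin_generated (R : realType) (V : lmodType R) (A : set V) : Prop :=
  forall P : set V, (forall p, A p -> P p) ->
    (forall a v w, P v -> P w -> P (a *: v + w)) -> P 0 -> forall v, P v.

Lemma spanned_generated (R : realType) (V : lmodType R) (A B : set V) :
  A `<=` B -> spanned_by A -> lin_generated B.
Proof.
move=> AB spanA P PB Plin P0 v.
have [n [a [p [Ap ->]]]] := spanA v.
apply: big_ind => // [x y Px Py|i _].
  by rewrite -[x]scale1r; apply: Plin.
by rewrite -[_ *: _]addr0; apply: Plin => //; apply/PB/AB.
Qed.

Section DerivativeMap.
Variables (R : realType) (V W : normedModType R).
Variables (C : set V) (u : V) (K : set W) (e : W).
Hypotheses (hC : is_order_unit_space C u) (hK : is_order_unit_space K e).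
Hypotheses (u0 : u != 0) (e0 : e != 0).
Variables (Psi : V -> W) (Phi : W -> V).
Hypothesis rev : order_reversal C K Psi Phi.
Hypothesis genC : lin_generated (extreme_vector C).

Ltac vecV := module_eq R V.
Ltac vecW := module_eq R W.

(** Minus the one-sided directional derivative of [Psi] at [x]. *)
Definition right_deriv (x v : V) : W :=
  lim (right_slope Psi x v t @[t --> 0^'+]).

Lemma right_deriv_unique (x v : V) (d : W) :
  right_slope Psi x v t @[t --> 0^'+] --> d -> right_deriv x v = d.
Proof. by apply: cvg_lim; exact: norm_hausdorff. Qed.

Lemma right_slope0 (x : V) : right_slope Psi x 0 t @[t --> 0^'+] --> 0.
Proof.
apply: cvg_near_cst; near=> t.
by rewrite /right_slope scaler0 addr0 subrr scaler0.
Unshelve. all: by end_near. Qed.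

(** The statement is relative to an arbitrary direction [v0] so that it is stable
    under linear combinations of [v]. *)
Lemma right_slope_lin (x v : V) : C° x -> exists d : W, forall a v0 (d0 : W),
  right_slope Psi x v0 t @[t --> 0^'+] --> d0 ->
  right_slope Psi x (v0 + a *: v) t @[t --> 0^'+] --> d0 + a *: d.
Proof.
move=> ix; move: v; apply: genC => [p extp|b v w [d vd] [d' wd']|].
- exists (ray_slope C Psi x p) => a v0 d0 h.
  exact: (right_slopeD hC hK u0 e0 rev ix extp h).
- exists (b *: d + d') => a v0 d0 h.
  have -> : v0 + a *: (b *: v + w) = v0 + (a * b) *: v + a *: w by vecV; ring.
  have -> : d0 + a *: (b *: d + d') = d0 + (a * b) *: d + a *: d' by vecW; ring.
  exact/wd'/vd.
- by exists 0 => a v0 d0; rewrite !scaler0 !addr0.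
Qed.

Lemma right_slope_cvg (x v : V) : C° x ->
  right_slope Psi x v t @[t --> 0^'+] --> right_deriv x v.
Proof.
move=> ix; have [d /(_ 1 0 0 (@right_slope0 x))] := right_slope_lin v ix.
by rewrite !scale1r !add0r => h; rewrite (right_deriv_unique h).
Qed.

Lemma right_deriv_lin (x : V) : C° x -> linear (right_deriv x).
Proof.
move=> ix a v w; have [d vd] := right_slope_lin v ix.
have := vd 1 0 0 (@right_slope0 x).
rewrite !scale1r !add0r => /right_deriv_unique ->.
rewrite [a *: v + w]addrC [RHS]addrC; apply: right_deriv_unique; apply: vd.
exact: right_slope_cvg.
Qed.

Lemma right_deriv_extreme (x p : V) : C° x -> extreme_vector C p ->
  right_deriv x p = ray_slope C Psi x p.
Proof.
move=> ix extp; apply: right_deriv_unique.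
have := right_slopeD hC hK u0 e0 rev (a := 1) ix extp (@right_slope0 x).
by rewrite !scale1r !add0r.
Qed.

Lemma right_deriv_ge0 (x v : V) : C° x -> C v -> K (right_deriv x v).
Proof.
move=> ix Cv.
apply: (closed_cvg K (cone_closed hK) _ _ (right_slope_cvg (v := v) ix)).
near=> t; have t0 : 0 < t by near: t; exact: nbhs_right_gt.
apply: (coneZ hK); first by rewrite invr_ge0 ltW.
apply/(rev_anti rev ix); first exact: (interiorD hC ix (coneZ hC (ltW t0) Cv)).
by apply: (cone_scaled hC t Cv (ltW t0)); vecV; ring.
Unshelve. all: by end_near. Qed.

Lemma reversal_scale (x : V) (a : R) : C° x -> 0 < a ->
  Psi (a *: x) = a^-1 *: Psi x.
Proof.
move=> ix a0; have iax := interiorZ hC a0 ix; have a0' : 0 <= a^-1 by rewrite invr_ge0 ltW.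
have h1 : K (a *: Psi (a *: x) - Psi x).
  by apply/(rev_le rev a iax ix); rewrite subrr; apply: (cone0 hC).
have h2 : K (a^-1 *: Psi x - Psi (a *: x)).
  apply/(rev_le rev a^-1 ix iax); rewrite scalerA mulVf ?gt_eqF // scale1r subrr.
  exact: (cone0 hC).
apply/eqP; rewrite -subr_eq0; apply/eqP/(cone_anti hK).
  by apply: (cone_scaled hK a^-1 h1) => //; vecW; field; rewrite gt_eqF.
by apply: (cone_scaled hK 1 h2) => //; vecW; ring.
Qed.

(** Euler's identity for a map that is homogeneous of degree [-1]. *)
Lemma right_deriv_base (x : V) : C° x -> right_deriv x x = Psi x.
Proof.
move=> ix; apply: right_deriv_unique.
rewrite -[X in _ --> X]scale1r -[X in X *: _]invr1 -[X in X^-1]addr0.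
have h : (1 + t)^-1 *: Psi x @[t --> 0^'+] --> (1 + 0)^-1 *: Psi x.
  apply: cvgZ; last exact: cvg_cst.
  apply: cvgV; first by rewrite addr0 oner_neq0.
  apply: cvgD; first exact: cvg_cst.
  exact: cvg_at_right_filter cvg_id.
apply: cvg_trans h; apply: near_eq_cvg; near=> t.
have t0 : 0 < t by near: t; exact: nbhs_right_gt.
have -> : (fun t => right_slope Psi x x t) t = t^-1 *: (Psi x - Psi ((1 + t) *: x)).
  by rewrite /right_slope scalerDl scale1r.
rewrite (reversal_scale ix) ?addr_gt0 //.
by vecW; field; rewrite !gt_eqF // addr_gt0.
Unshelve. all: by end_near. Qed.

End DerivativeMap.

(** * Transitivity *)

Section Inverse.
Variables (R : realType) (V W : normedModType R).
Variables (C : set V) (u : V) (K : set W) (e : W).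
Hypotheses (hC : is_order_unit_space C u) (hK : is_order_unit_space K e).
Hypotheses (u0 : u != 0) (e0 : e != 0).
Variables (Psi : V -> W) (Phi : W -> V).
Hypothesis rev : order_reversal C K Psi Phi.
Hypothesis genC : lin_generated (extreme_vector C).

Ltac vecW := module_eq R W.

(** Every [Psi x = D_x x] is a combination of the extreme vectors [D_x p], and the
    interior of [K] spans [W]. *)
Lemma image_generated : lin_generated (extreme_vector K).
Proof.
move=> P Pext Plin P0.
have PPsi x : C° x -> P (Psi x).
  move=> ix; rewrite -(right_deriv_base hC hK rev ix).
  move: (x in right_deriv _ _ x); apply: genC => [p extp|a v w Pv Pw|].
  - rewrite (right_deriv_extreme hC hK u0 e0 rev ix extp); apply: Pext.
    exact: (ray_slope_extreme hC hK u0 e0 rev).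
  - by rewrite (right_deriv_lin hC hK u0 e0 rev genC ix); apply: Plin.
  - by rewrite (right_deriv_unique (@right_slope0 _ _ _ Psi x)).
move=> w; have [l l0 [_ Kw]] := unit_dom hK w.
have iw := interiorD hK (interior_unit hK) Kw.
have -> : w = (- (l + 1)) *: e + (e + (l *: e + w)) by vecW; ring.
rewrite -{1}(revVK rev (interior_unit hK)) -(revVK rev iw).
by apply: Plin; apply/PPsi/(rev_int_inv rev) => //; apply: (interior_unit hK).
Qed.

Lemma right_deriv_inv (x v : V) : C° x ->
  right_deriv Phi (Psi x) (right_deriv Psi x v) = v.
Proof.
move=> ix; have iy := rev_int rev ix; have rev' := order_reversal_sym rev.
have linP := right_deriv_lin hC hK u0 e0 rev genC ix.
have linQ := right_deriv_lin hK hC e0 u0 rev' image_generated iy.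
move: v; apply: genC => [p extp|a v w IHv IHw|].
- rewrite (right_deriv_extreme hC hK u0 e0 rev ix extp).
  rewrite (right_deriv_extreme hK hC e0 u0 rev' iy).
    exact: (ray_slope_inv hC hK u0 e0 rev).
  exact: (ray_slope_extreme hC hK u0 e0 rev).
- by rewrite linP linQ IHv IHw.
- by rewrite !(right_deriv_unique (@right_slope0 _ _ _ _ _)).
Qed.

End Inverse.

Definition cone_conjugate (R : realType) (V : lmodType R) (C : set V)
    (x y : V) : Prop :=
  exists2 T : {linear V -> V}, cone_automorphism C T & T x = y.

Section Conjugacy.
Variables (R : realType) (V : lmodType R) (C : set V).

Lemma cone_conjugateP (f g : V -> V) (x : V) :
  linear f -> cancel f g -> cancel g f ->
  (forall v, C v -> C (f v)) -> (forall v, C v -> C (g v)) ->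
  cone_conjugate C x (f x).
Proof.
move=> linf fK gK Cf Cg.
pose T : {linear V -> V} := HB.pack f (GRing.isLinear.Build R V V *:%R f linf).
exists T => //; split; first by exists g.
apply/seteqP; split=> [_ [v Cv <-]|v Cv]; first exact: Cf.
by exists (g v); [exact: Cg|exact: gK].
Qed.

Lemma cone_conjugate_sym (x y : V) :
  cone_conjugate C x y -> cone_conjugate C y x.
Proof.
case=> T [[g TK gK] TC] <-; rewrite -[X in cone_conjugate _ _ X]TK.
apply: (@cone_conjugateP g T) => // [a v w|v|v].
- by rewrite -{1}[v]gK -{1}[w]gK -linearP TK.
- by rewrite -{1}TC => -[w Cw <-]; rewrite TK.
- by move=> Cv; rewrite -TC; exists v.
Qed.

Lemma cone_conjugate_trans (x y z : V) :
  cone_conjugate C x y -> cone_conjugate C y z -> cone_conjugate C x z.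
Proof.
case=> S [Sbij SC] <- [T [Tbij TC] <-].
exists (T \o S : {linear V -> V}) => //; split; first exact: bij_comp.
by rewrite -[in RHS]TC -[in RHS]SC image_comp.
Qed.

End Conjugacy.

Section Transitivity.
Variables (R : realType) (V W : normedModType R).
Variables (C : set V) (u : V) (K : set W) (e : W).
Hypotheses (hC : is_order_unit_space C u) (hK : is_order_unit_space K e).
Hypotheses (u0 : u != 0) (e0 : e != 0).
Variables (Psi : V -> W) (Phi : W -> V).
Hypothesis rev : order_reversal C K Psi Phi.
Hypothesis genC : lin_generated (extreme_vector C).

Ltac vecV := module_eq R V.

(** The automorphism is [E_(Psi z) D_x], with [D] and [E] the derivatives of [Psi]
    and [Phi], evaluated at [x] where [D_x x = Psi x]. *)
Lemma conjugate_base (x z : V) : C° x -> C° z ->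
  cone_conjugate C x (right_deriv Phi (Psi z) (Psi x)).
Proof.
move=> ix iz; have iy := rev_int rev ix; have it := rev_int rev iz.
have rev' := order_reversal_sym rev.
have genK := image_generated hC hK u0 e0 rev genC.
have DP := right_deriv_inv hC hK u0 e0 rev genC.
have DQ := right_deriv_inv hK hC e0 u0 rev' genK.
rewrite -(right_deriv_base hC hK rev ix).
pose f v := right_deriv Phi (Psi z) (right_deriv Psi x v).
apply: (@cone_conjugateP _ _ _ f
  (fun v => right_deriv Phi (Psi x) (right_deriv Psi z v))) => [a v w|v|v|v Cv|v Cv].
- rewrite /f (right_deriv_lin hC hK u0 e0 rev genC ix).
  by rewrite (right_deriv_lin hK hC e0 u0 rev' genK it).
- by have := DQ (Psi z) (right_deriv Psi x v) it; rewrite (revK rev iz) /f => ->; apply: DP.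
- by have := DQ (Psi x) (right_deriv Psi z v) iy; rewrite (revK rev ix) /f => ->; apply: DP.
- apply: (right_deriv_ge0 hK hC e0 u0 rev' genK it).
  exact: (right_deriv_ge0 hC hK u0 e0 rev genC ix).
- apply: (right_deriv_ge0 hK hC e0 u0 rev' genK iy).
  exact: (right_deriv_ge0 hC hK u0 e0 rev genC iz).
Qed.

(** The symmetry at [z = x + s p] moves [x] to [x + (2 s + s^2 lam) p]; the
    quadratic equation [2 s + s^2 lam = t] has a solution [s >= 0]. *)
Lemma conjugate_ray (x p : V) (t : R) : C° x -> extreme_vector C p -> 0 <= t ->
  cone_conjugate C x (x + t *: p).
Proof.
move=> ix extp t0; have [p0 Cp _] := extp.
have lam0 := gauge_gt0 hC u0 ix Cp p0.
have lamS := gauge_shift hC u0 ix Cp; set lam := gaugeM C p x in lam0 lamS.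
have lt0 : 0 <= lam * t by rewrite mulr_ge0 // ltW.
pose s := (Num.sqrt (1 + lam * t) - 1) / lam.
have s0 : 0 <= s.
  rewrite divr_ge0 ?(ltW lam0) // subr_ge0 -[leLHS]sqrtr1 ler_sqrt //; lra.
have sl : Num.sqrt (1 + lam * t) = 1 + s * lam by rewrite /s; field; lra.
have st : s + s * (1 + s * lam) = t.
  have : (1 + s * lam) ^+ 2 = 1 + lam * t by rewrite -sl sqr_sqrtr //; lra.
  by move=> h; apply: (mulfI (lt0r_neq0 lam0)); lra.
have sl0 : 0 < 1 + s * lam by rewrite ltr_wpDr // mulr_ge0 // ltW.
set z := x + s *: p.
have iz : C° z := interiorD hC ix (coneZ hC s0 Cp).
have zE : x = z + (- s) *: p by rewrite /z; vecV; ring.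
have ix' := ix; rewrite zE in ix'.
have [_ PsixE] := reversal_line hC hK u0 e0 rev iz extp ix'.
rewrite -zE lamS // in PsixE.
have rev' := order_reversal_sym rev.
have genK := image_generated hC hK u0 e0 rev genC.
have it := rev_int rev iz.
have := conjugate_base ix iz; congr cone_conjugate.
have -> : Psi x = (s * (1 + s * lam)) *: ray_slope C Psi z p + Psi z.
  by rewrite PsixE; module_eq R W; field; rewrite ?gt_eqF //; lra.
rewrite (right_deriv_lin hK hC e0 u0 rev' genK it) (right_deriv_base hK hC rev' it).
rewrite (right_deriv_extreme hK hC e0 u0 rev' it); last first.
  exact: (ray_slope_extreme hC hK u0 e0 rev).
rewrite (ray_slope_inv hC hK u0 e0 rev) // (revK rev iz) -st /z.
by vecV; ring.
Qed.

Lemma reversal_homogeneous : homogeneous_cone C.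
Proof.
(* [G] is a convex cone that contains the extreme vectors, so [G - G] is all of
   [V]; moving first by [g] and then by [- h] keeps the path in the interior. *)
pose G g := C g /\ forall (s : R) x, 0 <= s -> C° x -> cone_conjugate C x (x + s *: g).
have GZ a g : 0 <= a -> G g -> G (a *: g).
  move=> a0 [Cg gx]; split=> [|s x s0 ix]; first exact: (coneZ hC).
  by rewrite scalerA; apply: gx => //; apply: mulr_ge0.
have GD g h : G g -> G h -> G (g + h).
  move=> [Cg gx] [Ch hx]; split=> [|s x s0 ix]; first exact: (coneD hC).
  rewrite scalerDr addrA; apply: cone_conjugate_trans (gx _ _ s0 ix) _.
  by apply: hx => //; apply: (interiorD hC ix (coneZ hC s0 Cg)).
have G0 : G 0.
  split=> [|s x s0 ix]; first exact: (cone0 hC).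
  rewrite scaler0 addr0; exact: (@cone_conjugateP _ _ _ id id).
have GB v : exists g h, [/\ G g, G h & v = g - h].
  move: v; apply: genC => [p extp|a v w [g [h [Gg Gh ->]]] [g' [h' [Gg' Gh' ->]]]|].
  - exists p, 0; split=> //; last by rewrite subr0.
    by split=> [|s x s0 ix]; [case: extp|exact: conjugate_ray].
  - have [a0|a0] := leP 0 a.
      exists (a *: g + g'), (a *: h + h'); split; try by apply: GD => //; apply: GZ.
      by vecV; ring.
    have {}a0 : 0 <= - a by lra.
    exists ((- a) *: h + g'), ((- a) *: g + h').
    split; try by apply: GD => //; apply: GZ.
    by vecV; ring.
  - by exists 0, 0; rewrite subr0.
move=> x y ix iy; have [g [h [[_ gx] [_ hy] yx]]] := GB (y - x).
suff [T CT Tx] : cone_conjugate C x y by exists T.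
have := gx 1 x ler01 ix; rewrite scale1r => /cone_conjugate_trans; apply.
have -> : x + g = y + 1 *: h.
  by rewrite -[g](subrK h) -yx; vecV; ring.
exact/cone_conjugate_sym/hy.
Qed.

End Transitivity.

Section GaugeReversing.
Variables (R : realType) (V W : normedModType R).
Variables (C : set V) (u : V) (K : set W) (e : W).
Hypotheses (hC : is_order_unit_space C u) (hK : is_order_unit_space K e).

Lemma unit_eq0 (v : V) : u = 0 -> v = 0.
Proof.
move=> u0; have [l _ []] := unit_dom hC v.
rewrite u0 scaler0 sub0r add0r => CNv Cv; exact: (cone_anti hC).
Qed.

(** Nonzero units ensure that the gauge encodes the order, in both spaces. *)
Lemma gauge_reversing_order_reversal (Psi : V -> W) :
  u != 0 -> e != 0 -> gauge_reversing C K Psi ->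
  exists Phi, order_reversal C K Psi Phi.
Proof.
move=> u0 e0 [[Pint Pinj Psurj] Pgauge].
have PhiP y : exists x, K° y -> C° x /\ Psi x = y.
  have [iy|niy] := pselect (K° y); last by exists 0.
  by have [x ix xy] := Psurj y iy; exists x.
have [Phi PhiE] := choice PhiP.
have iPsi x : C° x -> K° (Psi x) by exact: Pint.
exists Phi; split=> // [y|x ix|y|x y m ix iy].
- by move/PhiE => [].
- have [iP PE] := PhiE _ (iPsi x ix).
  by apply: Pinj; rewrite ?inE.
- by move/PhiE => [].
- split=> [/(gauge_leP hC u0 iy)|/(gauge_leP hK e0 (iPsi _ ix))].
    by rewrite Pgauge // => /(gauge_leP hK e0 (iPsi _ ix)).
  by rewrite -Pgauge // => /(gauge_leP hC u0 iy).
Qed.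

End GaugeReversing.

Theorem theorem7p8 (R : realType) (V W : completeNormedModType R)
    (C : set V) (u : V) (K : set W) (e : W)
    (hV : is_order_unit_space C u) (hW : is_order_unit_space K e)
    (hatoms : spanned_by (atom C u))
    (hPsi : exists Psi : V -> W, gauge_reversing C K Psi) :
  homogeneous_cone C.
Proof.
have [Psi hrev] := hPsi.
have [u0|u0] := eqVneq u 0.
  move=> v w _ _; suff [T CT Tv] : cone_conjugate C v w by exists T.
  rewrite (unit_eq0 hV w u0) (unit_eq0 hV v u0).
  exact: (@cone_conjugateP _ _ _ id id).
(* If [e = 0] then [W = 0] and injectivity would identify [u] and [u + u]. *)
have [e0|e0] := eqVneq e 0.
  have [[_ Psi_inj _] _] := hrev.
  have iu := interior_unit hV; have i2u := interiorD hV iu (cone_unit hV).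
  have /eqP : u = u + u.
    apply: Psi_inj; rewrite ?inE //.
    by rewrite (unit_eq0 hW (Psi u) e0) (unit_eq0 hW (Psi (u + u)) e0).
  by rewrite -subr_eq0 opprD addNKr oppr_eq0 (negbTE u0).
have [Phi rev] := gauge_reversing_order_reversal hV hW u0 e0 hrev.
apply: (reversal_homogeneous hV hW u0 e0 rev).
by apply: spanned_generated hatoms => p [].
Qed.
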